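(* Let $G$ be a connected graph with $h_G\ge 3$ and $2h_G=N_G$. Then for every prime power $q$, $$c_2(G)^{\rm mom}_q\equiv c_2(G)_q \mod q.$$
   Context: Graphs are finite (multi)graphs. $N_G$ is the number of edges of $G$ and $h_G$ its first Betti number (number of independent cycles). Associate a variable $x_e$ to each edge. The graph polynomial is $\Psi_G(x)=\sum_T\prod_{e\notin T}x_e$, the sum being over spanning trees $T$ of $G$. For polynomials $P_1,\dots,P_\ell$ with integer coefficients in a given set of $N$ variables, $[P_1,\dots,P_\ell]_q$ denotes the number of common zeros in $\mathbb{F}_q^N$ of their reductions to $\mathbb{F}_q$. Parametric $c_2$ invariant: if $G$ has at least three vertices it is known that $q^2$ divides $[\Psi_G]_q$ (zeros counted in $\mathbb{F}_q^{N_G}$) for every prime power $q$, and $c_2(G)_q:=[\Psi_G]_q/q^2 \bmod q\in\mathbb{Z}/q\mathbb{Z}$. Momentum space $c_2$ invariant: orient the edges of $G$ and fix a basis $c_1,\dots,c_{h_G}$ of $H_1(G;\mathbb{Z})$, where $c_i=\sum_e c_{i,e}\,e$. To each basis cycle associate a momentum $p_i=(p_i^+,p_i^-,p_i'^+,p_i'^-)$ of four variables. For each edge $e$ let $p_e=\sum_i c_{i,e}p_i$ (componentwise), and let $Q_e(p)=p_e^+p_e^-+p_e'^+p_e'^-$, a polynomial with integer coefficients in the $4h_G$ variables. Writing $Q_1,\dots,Q_{N_G}$ for these polynomials, if $h_G\ge 2$ and $N_G\le 2h_G$ then $q^2$ divides $[Q_1Q_2\cdots Q_{N_G}]_q$ (zeros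 counted in $\mathbb{F}_q^{4h_G}$), and $c_2(G)^{\rm mom}_q:=[Q_1Q_2\cdots Q_{N_G}]_q/q^2 \bmod q$. This does not depend on the chosen cycle basis. *)

(* Defs.v *)
From HB Require Import structures.
From mathcomp Require Import all_boot all_order all_algebra.
From mathcomp Require Import mpoly.

Set Implicit Arguments.
Unset Strict Implicit.
Unset Printing Implicit Defensive.

Import GRing.Theory.
Local Open Scope ring_scope.

(* A finite multigraph, self-loops and parallel edges allowed. The choice of
   [src] and [tgt] orients the edges; only [boundary] depends on it. *)
Record multigraph := Multigraph {
  vertex : finType;
  edge : finType;
  src : edge -> vertex;
  tgt : edge -> vertex }.

Section Graph.
Variable G : multigraph.
Implicit Types (T : {set edge G}) (d : edge G * bool).

Definition adj T : rel (vertex G) := fun u v =>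
  [exists e in T, ((src e == u) && (tgt e == v))
               || ((src e == v) && (tgt e == u))].

Definition connected_by T : bool :=
  (0 < #|vertex G|)%N && [forall u, forall v, connect (adj T) u v].

Definition connected : bool := connected_by [set: edge G].

(* [(e, false)] is [e] traversed from [src e] to [tgt e], and [(e, true)] is
   [e] traversed backwards. *)
Definition dart_src d : vertex G := if d.2 then tgt d.1 else src d.1.
Definition dart_tgt d : vertex G := if d.2 then src d.1 else tgt d.1.

(* Distinctness of the edges, and not only of the vertices, excludes going back
   and forth along one edge. A loop is a cycle of length 1, and two parallel
   edges form a cycle of length 2. *)
Definition is_cycle (s : seq (edge G * bool)) : bool :=
  [&& (0 < size s)%N, uniq [seq d.1 | d <- s], uniq [seq dart_src d | d <- s]
    & cycle (fun d d' => dart_tgt d == dart_src d') s].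

(* Bounding the length by the number of edges loses nothing, since the edges of
   a cycle are distinct. *)
Definition acyclic T : bool :=
  [forall n : 'I_#|edge G|, forall s : n.+1.-tuple (edge G * bool),
     all (fun d => d.1 \in T) s ==> ~~ is_cycle s].

Definition spanning_tree T : bool := connected_by T && acyclic T.

Definition graph_poly : {mpoly int[#|edge G|]} :=
  \sum_(T : {set edge G} | spanning_tree T)
     \prod_(e : edge G | e \notin T) 'X_(enum_rank e).

(* The boundary map Z^E -> Z^V acts on row vectors of edge coefficients by right
   multiplication; H_1(G; Z) is its kernel. *)
Definition boundary : 'M[int]_(#|edge G|, #|vertex G|) :=
  \matrix_(e, v) ((tgt (enum_val e) == enum_val v)%:R
                - (src (enum_val e) == enum_val v)%:R).

Definition betti : nat :=
  \rank (kermx (map_mx intr boundary : 'M[rat]_(#|edge G|, #|vertex G|))).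

(* The rows of [c] form a Z-basis of H_1(G; Z). *)
Definition cycle_basis (c : 'M[int]_(betti, #|edge G|)) : Prop :=
  c *m boundary = 0 /\
  (forall z : 'rV[int]_#|edge G|, z *m boundary = 0 ->
     exists! a : 'rV[int]_betti, a *m c = z).

Section Momentum.
Variable c : 'M[int]_(betti, #|edge G|).

(* The components 0, 1, 2, 3 of a momentum are p^+, p^-, p'^+, p'^-. *)
Definition momentum (i : 'I_betti) (a : 'I_4) : {mpoly int[betti * 4]} :=
  'X_(mxvec_index i a).

Definition edge_momentum (e : edge G) (a : 'I_4) : {mpoly int[betti * 4]} :=
  \sum_(i < betti) c i (enum_rank e) *: momentum i a.

Definition edge_quadric (e : edge G) : {mpoly int[betti * 4]} :=
  edge_momentum e 0 * edge_momentum e 1 + edge_momentum e 2 * edge_momentum e 3.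

Definition momentum_poly : {mpoly int[betti * 4]} :=
  \prod_(e : edge G) edge_quadric e.

End Momentum.
End Graph.

Definition point_count (F : finFieldType) (n : nat) (P : seq {mpoly int[n]}) :
    nat :=
  #|[set x : {ffun 'I_n -> F}
      | all (fun p => (map_mpoly (intr : int -> F) p).@[x] == 0) P]|.

(* The two invariants at q = #|F|. The division by q^2 is exact for graphs with
   at least three vertices, respectively for graphs with at least two
   independent cycles and at most twice as many edges as independent cycles.
   Since #|F| >= 2, ['Z_#|F|] is Z/qZ. *)
Definition c2 (F : finFieldType) (G : multigraph) : 'Z_#|F| :=
  (point_count F [:: graph_poly G] %/ #|F| ^ 2)%N%:R.

Definition c2mom (F : finFieldType) (G : multigraph)
    (c : 'M[int]_(betti G, #|edge G|)) : 'Z_#|F| :=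
  (point_count F [:: momentum_poly c] %/ #|F| ^ 2)%N%:R.

(* Main.v *)
Require Import Defs.
From HB Require Import structures.
From mathcomp Require Import all_boot all_order all_algebra.
From mathcomp Require Import mpoly.
From mathcomp Require Import perm mxabelem ring zify.

Set Implicit Arguments.
Unset Strict Implicit.
Unset Printing Implicit Defensive.

Import Order.TTheory GRing.Theory Num.Theory.
Local Open Scope ring_scope.

(** Write q = #|F|, h for the Betti number, N = 2h for the number of edges, and A
for the h x N matrix over F whose rows are the basis cycles. Both sides are
governed by the Gram matrices M(a) = A diag(a) A^T, for a in F^N.

On the parametric side, M(a) is singular exactly when the graph polynomial
vanishes at a: by the matrix-tree theorem ([graph_poly_det]) the graph
polynomial is det M. So [graph_poly]_q is the number of a with M(a) singular.

On the momentum side, fix p^+ and p'^+. The quadrics Q_e become linear in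
(p^-, p'^-), so counting the momenta at which no Q_e vanishes is counting the
words of full support in a linear code. Passing to the dual code as in the
MacWilliams identity ([full_support_count]) and summing over p^+ and p'^+ gives
[num_nonvanishingE]: that number is the sum over a in F^N of
(#ker M(a))^2 w(a), where w(a) = (1 - q)^(number of zero coordinates of a).
The total q^(4h) of all momenta is divisible by q^3, so the theorem becomes
    sum_a (#ker M(a))^2 w(a) = - #{a | M(a) singular}   modulo q^3.

Since #ker M(a) is a power of q, its square is [M(a) nonsingular] plus
q (#ker M(a) - [M(a) nonsingular]) modulo q^3, and since the w(a) add up to 0,
the claim follows from divisibilities, where the powers of q in the expansion
of w come with the number of singular M(a) on coordinate subspaces:
 - sum_a #ker M(a) is divisible by q^h, because it counts pairs (a, x) with
   x M(a) = 0, which for fixed x is a linear system of h equations in a;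
 - #{a | M(a) singular} is divisible by q^2, also when one coordinate of a is
   set to 0, and by q when two coordinates are set to 0.

The last point is where the work lies. Modulo q^2 the number of nonsingular
M(a) is sum_a (#ker M(a))^2, which counts triples (a, x, y) with x and y in
ker M(a). For fixed x and y this is a linear system in a whose equations satisfy
a relation, because M(a) is symmetric, and it is unchanged under y -> y + t x;
each of the two facts yields a factor q when a has 2h coordinates
([dvd_num_singular_q2_even]). With one coordinate fewer the relation is used up,
and the triples are compared modulo q^2 with triples of another kind: pairs of
flows x A, y A and pairs of potentials f, g (vectors orthogonal to all flows)
with f_e (y A)_e = g_e (x A)_e for all e. Solving these for x and y instead of
f and g gains the missing factor ([dvd_num_singular_q2_odd]). *)

(** * Counting solutions of linear systems over a finite field *)

Section Counting.
Variable F : finFieldType.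
Local Notation q := (#|F|%:R : int).

Lemma q_neq0 : q != 0.
Proof. by rewrite pnatr_eq0 -lt0n; apply/card_gt0P; exists 0. Qed.

Lemma sumr_bool (T : finType) (P : pred T) :
  \sum_x (P x)%:R = #|[set x | P x]|%:R :> int.
Proof.
rewrite -sum1dep_card natr_sum [RHS]big_mkcond /=.
by apply: eq_bigr => x _; case: (P x).
Qed.

Lemma sum_kernel m n (B : 'M[F]_(m, n)) :
  \sum_(x : 'rV_m) (x *m B == 0)%:R = q ^+ (m - \rank B) :> int.
Proof.
rewrite sumr_bool -natrX -mxrank_ker -card_rowg.
congr (_%:R); apply: eq_card => x; rewrite inE mem_rowg.
by apply/eqP/idP => /sub_kermxP.
Qed.

(** Each independent relation among the n equations (a column of
    [W]) leaves one equation fewer to impose, hence one more factor q. *)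
Lemma dvd_sum_kernel k j m n (B : 'M[F]_(m, n)) (W : 'M[F]_(n, j)) :
  B *m W = 0 -> \rank W = j -> (k + n <= m + j)%N ->
  (q ^+ k %| \sum_(x : 'rV_m) (x *m B == 0)%:R)%Z.
Proof.
move=> BW0 rkW le_kn; rewrite sum_kernel; apply: dvdz_exp2l.
by have := mulmx0_rank_max BW0; rewrite rkW; lia.
Qed.

Lemma dvd_sum_ker0 k m n (B : 'M[F]_(m, n)) :
  (k + n <= m)%N -> (q ^+ k %| \sum_(x : 'rV_m) (x *m B == 0)%:R)%Z.
Proof.
move=> le_kn; apply: (@dvd_sum_kernel k 0 m n B 0); rewrite ?addn0 //.
  by rewrite mulmx0.
exact: mxrank0.
Qed.

Lemma sum_rV_split m n (f : 'rV[F]_(m + n) -> int) :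
  \sum_x f x = \sum_(x : 'rV_m) \sum_(y : 'rV_n) f (row_mx x y).
Proof.
rewrite pair_bigA /= (reindex (fun p : 'rV_m * 'rV_n => row_mx p.1 p.2)) //=.
exists (fun x => (lsubmx x, rsubmx x)) => [[x y] _ | x _] /=.
  by rewrite row_mxKl row_mxKr.
exact: hsubmxK.
Qed.

(** A function that is invariant under translation along [x] takes every
    value on whole lines, and the lines have q points each. *)
Lemma dvd_sum_line h (d : int) (x : 'rV[F]_h) (f : 'rV[F]_h -> int) :
  x != 0 -> (forall t y, f (y + t *: x) = f y) -> (forall y, (d %| f y)%Z) ->
  (q * d %| \sum_y f y)%Z.
Proof.
case/rV0Pn=> j xj_n0 fD fd.
(* Every line in direction [x] meets the hyperplane y_j = 0 exactly once. *)
have ->: \sum_y f y = q * \sum_(y : 'rV_h | y 0 j == 0) f y.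
  rewrite (partition_big (fun y : 'rV_h => y 0 j / x 0 j) predT) //=.
  transitivity (\sum_(t : F) \sum_(y : 'rV_h | y 0 j == 0) f y).
    apply: eq_bigr => t _.
    rewrite (reindex (fun y : 'rV_h => y + t *: x)) /=; last first.
      by exists (fun y : 'rV_h => y - t *: x) => y _; rewrite ?addrK ?subrK.
    apply: eq_big => [y | y _]; last exact: fD.
    rewrite !mxE mulrDl mulfK // -subr_eq0 addrK.
    by rewrite mulf_eq0 invr_eq0 (negPf xj_n0) orbF.
  by rewrite mulr_natl sumr_const.
apply: dvdz_mul => //; apply: rpred_sum => y _; exact: fd.
Qed.

End Counting.

(** * Gram matrices, coordinate selections and the Cauchy-Binet formula *)

Section GramMatrix.
Variable R : comNzRingType.

Lemma row_mul_diagC n (u v : 'rV[R]_n) : u *m diag_mx v = v *m diag_mx u.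
Proof. by apply/rowP=> j; rewrite !mul_mx_diag !mxE mulrC. Qed.

Lemma diag_mul_trC n (u v : 'rV[R]_n) : diag_mx u *m v^T = diag_mx v *m u^T.
Proof. by apply/colP=> j; rewrite !mul_diag_mx !mxE mulrC. Qed.

Definition gram h n (A : 'M[R]_(h, n)) (a : 'rV_n) : 'M_h :=
  A *m diag_mx a *m A^T.

(** For fixed [x], the condition that [x] lies in the kernel of the Gram
    matrix is linear in the weights [a]. *)
Lemma mul_gram h n (A : 'M[R]_(h, n)) x a :
  x *m gram A a = a *m (diag_mx (x *m A) *m A^T).
Proof. by rewrite /gram !mulmxA row_mul_diagC. Qed.

Definition ind_row n (S : {set 'I_n}) : 'rV[R]_n := \row_e (e \in S)%:R.

Lemma mul_ind_row n (S : {set 'I_n}) (a : 'rV[R]_n) e :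
  (a *m diag_mx (ind_row S)) 0 e = if e \in S then a 0 e else 0.
Proof. by rewrite mul_mx_diag !mxE; case: ifP; rewrite ?mulr1 ?mulr0. Qed.

(** Right multiplication extends by zero the rows indexed by [S]; right
    multiplication by the transpose restricts a row to [S]. *)
Definition sel_mx n (S : {set 'I_n}) : 'M[R]_(#|S|, n) :=
  \matrix_(i, j) (enum_val i == j)%:R.

Section Select.
Variables (n : nat) (S : {set 'I_n}).
Local Notation sel := (sel_mx S).

Lemma mul_sel_in (b : 'rV_#|S|) i : (b *m sel) 0 (enum_val i) = b 0 i.
Proof.
rewrite mxE (bigD1 i) //= mxE eqxx mulr1 big1 ?addr0 // => k /negPf ki.
by rewrite mxE (inj_eq enum_val_inj) ki mulr0.
Qed.

Lemma mul_sel_notin (b : 'rV_#|S|) e : e \notin S -> (b *m sel) 0 e = 0.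
Proof.
move=> eS; rewrite mxE big1 // => k _; rewrite mxE.
case: eqP => [ke|]; last by rewrite mulr0.
by have := enum_valP k; rewrite ke (negPf eS).
Qed.

Lemma mul_trsel m (B : 'M_(m, n)) i j : (B *m sel^T) i j = B i (enum_val j).
Proof.
rewrite mxE (bigD1 (enum_val j)) //= !mxE eqxx mulr1 big1 ?addr0 // => k /negPf kj.
by rewrite !mxE eq_sym kj mulr0.
Qed.

Lemma diag_mul_sel (b : 'rV_#|S|) : diag_mx (b *m sel) = sel^T *m diag_mx b *m sel.
Proof.
apply/matrixP=> i j; rewrite mul_mx_diag !mxE -sumrMnl; apply: eq_bigr => k _.
rewrite !mxE; case: (eqVneq i j) => [-> | ij]; last first.
  rewrite mulr0n; case: (eqVneq (enum_val k) i) => [-> | _]; last by rewrite !mul0r.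
  by rewrite (negPf ij) mulr0.
by case: eqP; rewrite ?mulr1 ?mul1r ?mulr0.
Qed.

Lemma ind_row_sel : ind_row S = const_mx 1 *m sel.
Proof.
apply/rowP=> e; rewrite [LHS]mxE; have [eS | eS] := boolP (e \in S).
  by rewrite -(enum_rankK_in eS eS) mul_sel_in mxE.
by rewrite mul_sel_notin.
Qed.

Lemma mul_trsel_sel : sel^T *m sel = diag_mx (ind_row S).
Proof. by rewrite ind_row_sel diag_mul_sel diag_const_mx mulmx1. Qed.

Lemma gram_sel h (A : 'M_(h, n)) b : gram A (b *m sel) = gram (A *m sel^T) b.
Proof. by rewrite /gram diag_mul_sel trmx_mul trmxK !mulmxA. Qed.

Lemma gram_ind h (A : 'M_(h, n)) :
  gram A (ind_row S) = (A *m sel^T) *m (A *m sel^T)^T.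
Proof. by rewrite ind_row_sel gram_sel /gram diag_const_mx mulmx1. Qed.

End Select.

Section CauchyBinet.
Variables (h n : nat) (A : 'M[R]_(h, n)).

(** A single value depends on the order in which the columns are chosen; the sum
    over all choices with image [S] is the square of the minor on [S]. *)
Definition minor (f : {ffun 'I_h -> 'I_n}) : R :=
  \prod_i A i (f i) * \det (\matrix_(i, j) A j (f i)).

Lemma det_gram_ffun (x : 'rV_n) :
  \det (gram A x) = \sum_(f : {ffun 'I_h -> 'I_n}) \prod_i x 0 (f i) * minor f.
Proof.
transitivity (\sum_(s : 'S_h) \sum_(f : {ffun 'I_h -> 'I_n})
   (-1) ^+ s * \prod_i (A i (f i) * x 0 (f i) * A (s i) (f i))).
  apply: eq_bigr => s _; rewrite -mulr_sumr; congr (_ * _).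
  rewrite -(bigA_distr_bigA (fun i e => A i e * x 0 e * A (s i) e)).
  apply: eq_bigr => i _; rewrite /gram mul_mx_diag mxE; apply: eq_bigr => e _.
  by rewrite !mxE.
rewrite exchange_big /=; apply: eq_bigr => f _.
rewrite /minor mulrA mulr_sumr; apply: eq_bigr => s _.
rewrite mulrCA -!big_split /=; congr (_ * _).
by apply: eq_bigr => i _; rewrite !mxE (mulrC (x 0 _)).
Qed.

Lemma minor_noninj (f : {ffun 'I_h -> 'I_n}) : ~~ injectiveb f -> minor f = 0.
Proof.
case/injectivePn=> i [j ij fij]; rewrite /minor.
rewrite (determinant_alternate ij) ?mulr0 // => k.
by rewrite !mxE fij.
Qed.

(** The Cauchy-Binet formula for a Gram matrix. The coefficient of a
    square-free monomial, normally a squared minor, is written here as the value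
    of the determinant at the indicator of the monomial: this avoids casts
    between minors of provably equal sizes, and it is legitimate because a set
    of [h] columns contains no other such set. *)
Lemma det_gram_sum (x : 'rV_n) :
  \det (gram A x) =
  \sum_(S : {set 'I_n} | #|S| == h) \prod_(e in S) x 0 e * \det (gram A (ind_row S)).
Proof.
pose minors (S : {set 'I_n}) : R :=
  \sum_(f : {ffun 'I_h -> 'I_n} | injectiveb f && (f @: 'I_h == S)) minor f.
have expand (y : 'rV_n) : \det (gram A y) =
    \sum_(S : {set 'I_n} | #|S| == h) \prod_(e in S) y 0 e * minors S.
  rewrite det_gram_ffun (bigID (fun f : {ffun 'I_h -> 'I_n} => injectiveb f)) /=.
  rewrite [X in _ + X]big1 => [|f /minor_noninj->]; last by rewrite mulr0.
  rewrite addr0 (partition_big (fun f : {ffun 'I_h -> 'I_n} => f @: 'I_h)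
    (fun S => #|S| == h)) /=; last first.
    by move=> f /injectiveP fI; rewrite card_imset ?card_ord.
  apply: eq_bigr => S _; rewrite mulr_sumr; apply: eq_bigr => f.
  case/andP=> /injectiveP fI /eqP <-; congr (_ * _).
  by rewrite big_imset //=; move=> ? ? _ _; exact: fI.
rewrite expand; apply: eq_bigr => S /eqP cS; congr (_ * _).
rewrite expand (bigD1 S) ?cS //= [X in _ + X]big1 ?addr0.
  by rewrite big1 ?mul1r // => e eS; rewrite mxE eS.
move=> S' /andP[/eqP cS' SS'].
have /subsetPn[e eS' eS] : ~~ (S' \subset S).
  by apply: contra SS' => ss; rewrite eqEcard ss cS cS' /=.
by rewrite (bigD1 e) //= mxE (negPf eS) !mul0r.
Qed.

End CauchyBinet.
End GramMatrix.

(** * Singular Gram matrices with twice as many weights as the dimension *)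

Section Gram.
Variable F : finFieldType.
Local Notation q := (#|F|%:R : int).

Variables (h n : nat) (A : 'M[F]_(h, n)).
Implicit Types (a : 'rV[F]_n) (x y : 'rV[F]_h).

Definition kersize a : int := \sum_(x : 'rV_h) (x *m gram A a == 0)%:R.

Definition num_singular : int := \sum_a (\det (gram A a) == 0)%:R.

Lemma kersizeE a : kersize a = q ^+ (h - \rank (gram A a)).
Proof. exact: sum_kernel. Qed.

Definition nondegenerate a : bool := \det (gram A a) != 0.

Lemma nondeg_corank a : nondegenerate a = (h - \rank (gram A a) == 0)%N.
Proof.
rewrite /nondegenerate -unitfE -unitmxE -row_full_unit subn_eq0.
by rewrite /row_full eqn_leq rank_leq_col.
Qed.

Lemma kersize_mod_q a : (q %| kersize a - (nondegenerate a)%:R)%Z.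
Proof.
rewrite kersizeE nondeg_corank; case: (h - _)%N => [|k]; first by rewrite subrr.
by rewrite subr0 exprS dvdz_mulr.
Qed.

Lemma kersize_sqr_mod_q2 a : (q ^+ 2 %| kersize a ^+ 2 - (nondegenerate a)%:R)%Z.
Proof.
rewrite kersizeE nondeg_corank; case: (h - _)%N => [|k]; first by rewrite expr1n subrr.
by rewrite subr0 -exprM; apply: dvdz_exp2l; lia.
Qed.

(** For q^k with k = 0, 1 both sides of the congruence agree
    exactly, and for k >= 2 all terms vanish modulo q^3. The point is that
    coranks need not be separated: the correction is q times a quantity that is
    already controlled modulo q^2. *)
Lemma kersize_sqr_mod_q3 a :
  (q ^+ 3 %| kersize a ^+ 2 - (nondegenerate a)%:R
             - q * (kersize a - (nondegenerate a)%:R))%Z.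
Proof.
rewrite kersizeE nondeg_corank; case: (h - _)%N => [|[|k]].
- by rewrite expr1n !subrr mulr0.
- by rewrite expr1 !subr0 -expr2 subrr.
rewrite /= !subr0 -exprM -exprS; apply: rpredB; apply: dvdz_exp2l; lia.
Qed.

Lemma num_singularE : num_singular = q ^+ n - \sum_a (nondegenerate a)%:R.
Proof.
have ->: q ^+ n = \sum_(a : 'rV[F]_n) 1.
  by rewrite sumr_const card_mx mul1n natrX.
rewrite -sumrB; apply: eq_bigr => a _; rewrite /nondegenerate; case: eqP => _ /=; lia.
Qed.

(** Exchange the two sums: for each of the vectors [x] the weights [a]
    solve [h] linear equations. *)
Lemma dvd_sum_kersize : (q ^+ (n - h) %| \sum_a kersize a)%Z.
Proof.
rewrite exchange_big /=; apply: rpred_sum => x _.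
under eq_bigr do rewrite mul_gram.
have [le_hn | lt_nh] := leqP h n; first by apply: dvd_sum_ker0; lia.
by rewrite (_ : (n - h = 0)%N) //; lia.
Qed.

Lemma dvd_num_singular_q : (h < n)%N -> (q %| num_singular)%Z.
Proof.
move=> lt_hn; rewrite num_singularE.
have n_gt0: (0 < n)%N by lia.
apply: rpredB.
  exact: dvdz_exp n_gt0 (dvdzz q).
have ->: \sum_a (nondegenerate a)%:R =
  \sum_a kersize a - \sum_a (kersize a - (nondegenerate a)%:R).
  by rewrite sumrB subKr.
apply: rpredB; last by apply: rpred_sum => a _; exact: kersize_mod_q.
apply: dvdz_trans dvd_sum_kersize; by apply: dvdz_exp => //; lia.
Qed.

Definition num_joint x y : int :=
  \sum_a ((x *m gram A a == 0) && (y *m gram A a == 0))%:R.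

Lemma sum_num_joint : \sum_a kersize a ^+ 2 = \sum_x \sum_y num_joint x y.
Proof.
under [RHS]eq_bigr do rewrite exchange_big /=.
rewrite exchange_big /=; apply: eq_bigr => a _.
rewrite expr2 /kersize mulr_suml; apply: eq_bigr => x _.
by rewrite mulr_sumr; apply: eq_bigr => y _; rewrite -natrM mulnb.
Qed.

(** The square of the size of the kernel is 1 or divisible by
    q^2, so modulo q^2 the sum of the squares counts the nonsingular matrices. *)
Lemma dvd_num_singular_of_joint :
  (1 < n)%N -> (q ^+ 2 %| \sum_x \sum_y num_joint x y)%Z -> (q ^+ 2 %| num_singular)%Z.
Proof.
move=> n_gt1 dv; rewrite num_singularE; apply: rpredB; first exact: dvdz_exp2l.
have ->: \sum_a (nondegenerate a)%:R =
  \sum_a kersize a ^+ 2 - \sum_a (kersize a ^+ 2 - (nondegenerate a)%:R).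
  by rewrite sumrB subKr.
rewrite sum_num_joint; apply: rpredB => //.
by apply: rpred_sum => a _; exact: kersize_sqr_mod_q2.
Qed.

Lemma num_joint_shear x y t : num_joint x (y + t *: x) = num_joint x y.
Proof.
apply: eq_bigr => a _; case: eqP => //= xa0.
by rewrite mulmxDl -scalemxAl xa0 scaler0 addr0.
Qed.

Lemma num_joint_mx x y : num_joint x y =
  \sum_(a : 'rV_n) (a *m row_mx (diag_mx (x *m A) *m A^T)
                            (diag_mx (y *m A) *m A^T) == 0)%:R.
Proof.
apply: eq_bigr => a _; rewrite !mul_gram mul_mx_row; congr (nat_of_bool _)%:R.
apply/andP/eqP => [[/eqP-> /eqP->]|]; first exact: row_mx0.
by rewrite -[RHS]row_mx0 => /eq_row_mx [-> ->].
Qed.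

Lemma dvd_num_joint_0l y k : (k + h <= n)%N -> (q ^+ k %| num_joint 0 y)%Z.
Proof.
move=> le_khn; rewrite /num_joint.
under eq_bigr do rewrite mul0mx eqxx /= mul_gram.
by apply: dvd_sum_ker0; lia.
Qed.

Lemma rank_col_neq0 m (v : 'cV[F]_m) : v != 0 -> \rank v = 1%N.
Proof. by move=> v0; apply/eqP; rewrite eqn_leq rank_leq_col lt0n mxrank_eq0. Qed.

(** The bilinear form of a Gram matrix is symmetric: the value of
    x M(a) on y equals that of y M(a) on x. *)
Lemma num_joint_antisym x y :
  row_mx (diag_mx (x *m A) *m A^T) (diag_mx (y *m A) *m A^T)
    *m col_mx y^T (- x^T) = 0.
Proof.
rewrite mul_row_col mulmxN -!mulmxA -!trmx_mul diag_mul_trC subrr //.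
Qed.

Lemma dvd_num_joint x y : x != 0 -> (2 * h <= n)%N -> (q %| num_joint x y)%Z.
Proof.
move=> x0 le_n; rewrite num_joint_mx -[q]expr1.
apply: (dvd_sum_kernel (num_joint_antisym x y)); last by lia.
apply: rank_col_neq0; apply: contra x0 => /eqP.
rewrite -[0]col_mx0 => /eq_col_mx [_ /eqP].
by rewrite oppr_eq0 trmx_eq0.
Qed.

(** One factor q comes from the relation between the equations,
    the other from the freedom to add multiples of [x] to [y]. *)
Lemma dvd_num_singular_q2_even :
  (2 <= h)%N -> n = (2 * h)%N -> (q ^+ 2 %| num_singular)%Z.
Proof.
move=> h2 n2h; apply: dvd_num_singular_of_joint; first by lia.
apply: rpred_sum => x _; have [-> | x0] := eqVneq x 0.
  by apply: rpred_sum => y _; apply: dvd_num_joint_0l; lia.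
rewrite expr2; apply: (dvd_sum_line x0) => y; first by move=> ?; apply: num_joint_shear.
by apply: dvd_num_joint => //; lia.
Qed.

End Gram.

(** * Singular Gram matrices with one weight fewer *)

Section OddGram.
Variable F : finFieldType.
Local Notation q := (#|F|%:R : int).
Variables (h n : nat) (A : 'M[F]_(h, n)).
Implicit Types (f g : 'rV[F]_n) (x y : 'rV[F]_h).

(** The elements [f] of the kernel of [A^T] are the potentials, that is,
    the vectors orthogonal to all flows. If [a] kills [x] and [y], then
    f = a (x A) and g = a (y A) are potentials with f (y A) = g (x A), and this
    is the system that is counted. *)
Definition num_potentials x y : int :=
  \sum_(f : 'rV[F]_n) \sum_(g : 'rV[F]_n) [&& f *m A^T == 0, g *m A^T == 0 &
                 f *m diag_mx (y *m A) == g *m diag_mx (x *m A)]%:R.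

(** Replacing y by y + t x is compensated by replacing g by
    g + t f. *)
Lemma num_potentials_shear x y t : num_potentials x (y + t *: x) = num_potentials x y.
Proof.
apply: eq_bigr => f _.
rewrite (reindex (fun g : 'rV_n => g + t *: f)) /=; last first.
  by exists (fun g : 'rV_n => g - t *: f) => g _; rewrite ?addrK ?subrK.
apply: eq_bigr => g _; congr (nat_of_bool _)%:R.
case: eqP => //= fA0; congr andb.
  by rewrite mulmxDl -scalemxAl fA0 scaler0 addr0.
rewrite mulmxDl linearD /= mulmxDr -!scalemxAl linearZ /= -scalemxAr mulmxDl.
by rewrite -!scalemxAl (inj_eq (addIr _)).
Qed.

Lemma dvd_num_potentials_0l y k : (k + h <= n)%N -> (q ^+ k %| num_potentials 0 y)%Z.
Proof.
move=> le_kn; apply: rpred_sum => f _.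
under eq_bigr do rewrite mul0mx linear0 mulmx0.
case: (f *m A^T == 0) => /=; last by rewrite big1.
case: (_ == 0); last by rewrite big1 // => g _; rewrite andbF.
by under eq_bigr do rewrite andbT; apply: dvd_sum_ker0.
Qed.

Lemma num_potentials_mx x y : num_potentials x y =
  \sum_(f : 'rV[F]_(n + n)) (f *m row_mx (block_mx A^T 0 0 A^T)
                (col_mx (diag_mx (y *m A)) (- diag_mx (x *m A))) == 0)%:R.
Proof.
rewrite sum_rV_split; apply: eq_bigr => f _; apply: eq_bigr => g _.
congr (nat_of_bool _)%:R; rewrite mul_mx_row mul_row_block mul_row_col.
rewrite !mulmx0 addr0 add0r mulmxN.
apply/and3P/eqP => [[/eqP-> /eqP-> /eqP->]|]; first by rewrite subrr !row_mx0.
rewrite -[RHS]row_mx0 => /eq_row_mx [].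
rewrite -[X in _ = X -> _]row_mx0 => /eq_row_mx [-> ->] /eqP.
by rewrite subr_eq0.
Qed.

(** There are 2h + n equations in 2n unknowns. One relation
    expresses that flows are orthogonal to potentials; the equation at [z] is
    void and gives a second relation. *)
Lemma dvd_num_potentials_zero x y (z : 'I_n) : (2 * h <= n.+1)%N -> (1 < n)%N ->
  (x *m A) 0 z = 0 -> (y *m A) 0 z = 0 -> (q %| num_potentials x y)%Z.
Proof.
move=> le_hn n_gt1 xz yz; rewrite num_potentials_mx -[q]expr1.
(* The two columns are the orthogonality relation and the void equation at [z]. *)
pose W : 'M[F]_((h + h) + n, 1 + 1) :=
  row_mx (col_mx (col_mx (- y^T) x^T) (const_mx 1)) (col_mx 0 (delta_mx z 0)).
apply: (@dvd_sum_kernel _ _ (1 + 1) _ _ _ W); last by lia.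
  have diag1 (u : 'rV[F]_n) : diag_mx u *m const_mx 1 = u^T :> 'cV[F]_n.
    by apply/colP=> j; rewrite mul_diag_mx !mxE mulr1.
  have diagz (u : 'rV[F]_n) : u 0 z = 0 -> diag_mx u *m delta_mx z 0 = 0 :> 'cV[F]_n.
    move=> uz; apply/colP=> j; rewrite mul_diag_mx !mxE.
    by case: eqP => [-> | _]; rewrite ?uz ?mul0r ?mulr0.
  rewrite /W mul_mx_row !mul_row_col mulmx0 add0r mul_block_col !mul0mx.
  rewrite addr0 add0r !mul_col_mx !mulNmx !diag1 !diagz // oppr0 col_mx0.
  by rewrite mulmxN -!trmx_mul add_col_mx subrr addNr col_mx0 row_mx0.
(* The coordinates [j] and [z] of the last block separate the two relations. *)
have [j jz] : exists j : 'I_n, j != z.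
  have n_gt0 : (0 < n)%N by lia.
  have [z0 | z0] := eqVneq z (Ordinal n_gt0).
    by exists (Ordinal n_gt1); rewrite z0 -val_eqE.
  by exists (Ordinal n_gt0); rewrite eq_sym.
pose Y : 'M[F]_(1 + 1, (h + h) + n) :=
  col_mx (row_mx 0 (delta_mx 0 j)) (row_mx 0 (delta_mx 0 z - delta_mx 0 j)).
apply/eqP; rewrite eqn_leq rank_leq_col /=.
apply: (@mulmx1_min_rank _ (1 + 1) _ _ W Y 1%:M).
have row1 (i : 'I_n) : delta_mx 0 i *m const_mx 1 = 1%:M :> 'M[F]_1.
  by rewrite -rowE row_const; apply/matrixP=> k l; rewrite !ord1 !mxE.
have rowz (i : 'I_n) : delta_mx 0 i *m delta_mx z 0 =
    (if i == z then 1%:M else 0) :> 'M[F]_1.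
  rewrite -rowE; apply/matrixP=> k l; rewrite !ord1 !mxE eqxx andbT.
  by case: eqP; rewrite !mxE.
rewrite mulmx1 mul_col_row !mul_row_col !mulmx0 !mul0mx !add0r !mulmxBl.
by rewrite !row1 !rowz (negPf jz) eqxx subrr subr0 -scalar_mx_block.
Qed.

(** The weight at [z] is unconstrained. *)
Lemma dvd_num_joint_zero x y (z : 'I_n) :
  (x *m A) 0 z = 0 -> (y *m A) 0 z = 0 -> (q %| num_joint A x y)%Z.
Proof.
move=> xz yz; rewrite num_joint_mx.
set B := row_mx _ _; rewrite sum_kernel; apply: dvdz_exp => //.
rewrite subn_gt0 ltn_neqAle rank_leq_row andbT.
have diagz (u : 'rV[F]_n) : u 0 z = 0 -> delta_mx 0 z *m diag_mx u = 0 :> 'rV[F]_n.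
  move=> uz; apply/rowP=> j; rewrite mul_mx_diag !mxE eqxx /=.
  by case: eqP => [-> | _]; rewrite ?uz ?mul0r ?mulr0.
have dB : delta_mx 0 z *m B = 0 :> 'rV_(h + h).
  by rewrite mul_mx_row !mulmxA !diagz // mul0mx row_mx0.
apply/negP => /row_free_inj inj.
have := inj 1%N (delta_mx 0 z) 0; rewrite mul0mx => /(_ dB).
by move/rowP/(_ z)/eqP; rewrite !mxE !eqxx oner_eq0.
Qed.

(** If xA and yA have no common zero, the weights are recovered
    from the potentials as the quotients f / (x A) or g / (y A). *)
Lemma num_joint_potentials x y :
  (forall z, ((x *m A) 0 z != 0) || ((y *m A) 0 z != 0)) ->
  num_joint A x y = num_potentials x y.
Proof.
rewrite /num_joint /num_potentials; under eq_bigr do rewrite !mul_gram !mulmxA.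
move: (x *m A) (y *m A) => u v nz.
pose div_pot (p : 'rV[F]_n * 'rV[F]_n) : 'rV[F]_n :=
  \row_j (if u 0 j != 0 then p.1 0 j / u 0 j else p.2 0 j / v 0 j).
pose mul_pot (a : 'rV[F]_n) := (a *m diag_mx u, a *m diag_mx v).
have compat (p : 'rV[F]_n * 'rV[F]_n) :
    p.1 *m diag_mx v = p.2 *m diag_mx u -> mul_pot (div_pot p) = p.
  case: p => f g /= /rowP E; congr pair; apply/rowP=> j; have := E j.
  - rewrite !mul_mx_diag !mxE /=; case: ifP => [u0 _ | /negbFE /eqP u0].
      by rewrite divfK.
    rewrite u0 !mulr0 => /eqP; rewrite mulf_eq0 => /orP[/eqP-> // |].
    by have := nz j; rewrite u0 eqxx /= => /negPf ->.
  - rewrite !mul_mx_diag !mxE /=; case: ifP => [u0 E' | /negbFE /eqP u0 _].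
      by rewrite mulrAC E' mulfK.
    by rewrite divfK //; have := nz j; rewrite u0 eqxx.
have comm_diag (a : 'rV[F]_n) :
    a *m diag_mx u *m diag_mx v = a *m diag_mx v *m diag_mx u.
  by apply/rowP=> j; rewrite !mul_mx_diag !mxE mulrAC.
rewrite pair_bigA /= (bigID (fun p : 'rV[F]_n * 'rV[F]_n =>
  p.1 *m diag_mx v == p.2 *m diag_mx u)) /= [X in _ = _ + X]big1; last first.
  by move=> p /negPf ->; rewrite !andbF.
rewrite addr0 (reindex_onto mul_pot div_pot) /=; last by move=> p /eqP; exact: compat.
apply: eq_big => [a | a _]; last first.
  by rewrite comm_diag eqxx andbT.
rewrite comm_diag eqxx /=; apply/esym/eqP/rowP=> j.
rewrite mxE /= !mul_mx_diag !mxE; case: ifP => [u0 | /negbFE u0]; first by rewrite mulfK.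
by rewrite mulfK //; have := nz j; rewrite u0.
Qed.

(** For fixed potentials [f] and [g], the condition is a system of
    n linear equations in the 2h coordinates of [x] and [y], and the sum of these
    equations is trivial by orthogonality of flows and potentials. *)
Lemma dvd_sum_num_potentials : (0 < n)%N -> (n < 2 * h)%N ->
  (q ^+ 2 %| \sum_x \sum_y num_potentials x y)%Z.
Proof.
move=> n_gt0 lt_n.
under eq_bigr do rewrite exchange_big /=.
rewrite exchange_big /=; apply: rpred_sum => f _.
under eq_bigr do rewrite exchange_big /=.
rewrite exchange_big /=; apply: rpred_sum => g _.
case: eqP => [fA0 | _] /=; last by rewrite big1 // => x _; rewrite big1.
case: eqP => [gA0 | _] /=; last by rewrite big1 // => x _; rewrite big1.
have diag1 (e : 'rV[F]_n) : diag_mx e *m const_mx 1 = e^T :> 'cV[F]_n.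
  by apply/colP=> j; rewrite mul_diag_mx !mxE mulr1.
pose B := col_mx (- (A *m diag_mx g)) (A *m diag_mx f).
have ->: \sum_(x : 'rV[F]_h) \sum_(y : 'rV[F]_h)
     (f *m diag_mx (y *m A) == g *m diag_mx (x *m A))%:R
   = \sum_(w : 'rV_(h + h)) (w *m B == 0)%:R :> int.
  rewrite sum_rV_split; apply: eq_bigr => x _; apply: eq_bigr => y _.
  rewrite mul_row_col mulmxN !mulmxA addrC subr_eq0.
  by rewrite ![_ *m A *m _]row_mul_diagC.
apply: (@dvd_sum_kernel _ _ 1 _ _ _ (const_mx 1)); last by lia.
  rewrite mul_col_mx mulNmx -!mulmxA !diag1.
  by rewrite -[A]trmxK -!trmx_mul fA0 gA0 trmx0 oppr0 col_mx0.
apply: rank_col_neq0; apply/eqP=> /colP/(_ (Ordinal n_gt0))/eqP.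
by rewrite !mxE oner_eq0.
Qed.

(** The joint kernel count and the count of potentials agree modulo
    q for each nonzero [x] and are invariant under shears of [y]; so they agree
    modulo q^2 after summation over [y]. The sum of the potential counts
    over all [x] and [y] is divisible by q^2. *)
Lemma dvd_num_singular_q2_odd :
  (3 <= h)%N -> n.+1 = (2 * h)%N -> (q ^+ 2 %| num_singular A)%Z.
Proof.
move=> h3 n2h; apply: dvd_num_singular_of_joint; first by lia.
have ->: \sum_x \sum_y num_joint A x y =
  \sum_x \sum_y num_potentials x y + \sum_x \sum_y (num_joint A x y - num_potentials x y).
  rewrite -big_split /=; apply: eq_bigr => x _.
  by rewrite -big_split /=; apply: eq_bigr => y _; rewrite addrC subrK.
apply: rpredD; first by apply: dvd_sum_num_potentials; lia.
apply: rpred_sum => x _; have [-> | x0] := eqVneq x 0.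
  apply: rpred_sum => y _; apply: rpredB; first by apply: dvd_num_joint_0l; lia.
  by apply: dvd_num_potentials_0l; lia.
rewrite expr2; apply: (dvd_sum_line x0) => y.
  by move=> ?; rewrite num_joint_shear num_potentials_shear.
have [/forallP nz|] :=
  boolP [forall z, ((x *m A) 0 z != 0) || ((y *m A) 0 z != 0)].
  by rewrite num_joint_potentials // subrr.
rewrite negb_forall => /existsP[z]; rewrite negb_or !negbK => /andP[/eqP xz /eqP yz].
apply: rpredB; first by exact: dvd_num_joint_zero xz yz.
by apply: dvd_num_potentials_zero xz yz; lia.
Qed.

End OddGram.

(** * Words of full support in a linear code *)

Section FullSupport.
Variable F : finFieldType.
Local Notation q := (#|F|%:R : int).

Lemma sum_rV_prod n (f : 'I_n -> F -> int) :
  \sum_(a : 'rV[F]_n) \prod_e f e (a 0 e) = \prod_e \sum_t f e t.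
Proof.
rewrite bigA_distr_bigA (reindex (fun g : {ffun 'I_n -> F} => \row_e g e)) /=.
  by apply: eq_bigr => g _; apply: eq_bigr => e _; rewrite mxE.
exists (fun a : 'rV[F]_n => [ffun e => a 0 e]) => [g _ | a _].
  by apply/ffunP=> e; rewrite ffunE mxE.
by apply/rowP=> e; rewrite mxE ffunE.
Qed.

Lemma forall_prodr (I : finType) (P : pred I) :
  ([forall e, P e])%:R = \prod_e (P e)%:R :> int.
Proof.
have [/forallP PT | ] := boolP [forall e, P e].
  by rewrite big1 // => e _; rewrite PT.
rewrite negb_forall => /existsP[e /negPf Pe].
by rewrite (bigD1 e) //= Pe mul0r.
Qed.

Lemma rV_eqE (T : eqType) n (a b : 'rV[T]_n) : (a == b) = [forall e, a 0 e == b 0 e].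
Proof. by apply/eqP/forallP => [-> // | E]; apply/rowP=> e; apply/eqP. Qed.

(** Setting the coordinates outside [S] to zero is q-to-one in each of
    these coordinates. *)
Lemma sum_mul_ind_row n (S : {set 'I_n}) (f : 'rV[F]_n -> int) :
  \sum_b f (b *m diag_mx (ind_row F S)) =
  \sum_a f a * \prod_e (if e \in S then 1 else q * (a 0 e == 0)%:R).
Proof.
rewrite (partition_big (fun b => b *m diag_mx (ind_row F S)) predT) //=.
apply: eq_bigr => a _.
rewrite (eq_bigr (fun=> f a)) => [|b /eqP-> //].
transitivity (f a * \sum_(b : 'rV_n) (b *m diag_mx (ind_row F S) == a)%:R).
  rewrite big_mkcond mulr_sumr /=; apply: eq_bigr => b _.
  by case: ifP; rewrite ?mulr1 ?mulr0.
congr (_ * _).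
under [LHS]eq_bigr => b _.
  rewrite rV_eqE; under eq_forallb do rewrite mul_ind_row.
  rewrite forall_prodr.
over.
rewrite (sum_rV_prod (fun e t => ((if e \in S then t else 0) == a 0 e)%:R)).
apply: eq_bigr => e _; case: (e \in S).
  rewrite (bigD1 (a 0 e)) //= eqxx big1 ?addr0 // => t /negPf-> //.
by rewrite sumr_const eq_sym mulr_natl.
Qed.

(** The unnormalized Fourier transform of the indicator of the vectors without
    zero coordinates. *)
Definition wt n (a : 'rV[F]_n) : int := \prod_e (q * (a 0 e == 0)%:R - 1).

(** The MacWilliams identity for words of full support. By
    inclusion-exclusion it reduces to words that vanish on a set of coordinates,
    and for these it says that a matrix and its transpose have the same rank. *)
Lemma full_support_count m n (B : 'M[F]_(m, n)) :
  q ^+ n * \sum_(y : 'rV_m) [forall e, (y *m B) 0 e != 0]%:R =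
  q ^+ m * \sum_(a : 'rV_n) (a *m B^T == 0)%:R * wt a.
Proof.
(* The indicator of full support is the product over [e] of 1 - [t_e = 0]. *)
pose sg (S : {set 'I_n}) : int := \prod_e (if e \in S then -1 else 1).
have -> : \sum_(y : 'rV_m) [forall e, (y *m B) 0 e != 0]%:R =
    \sum_S sg S * \sum_(y : 'rV_m) (y *m (B *m diag_mx (ind_row F S)) == 0)%:R :> int.
  under [RHS]eq_bigr do rewrite mulr_sumr.
  rewrite exchange_big /=; apply: eq_bigr => y _.
  rewrite forall_prodr.
  under [LHS]eq_bigr => e _.
    have -> : ((y *m B) 0 e != 0)%:R = (- ((y *m B) 0 e == 0)%:R + 1 : int).
      by case: (_ == 0).
  over.
  rewrite bigA_distr /=; apply: eq_bigr => S _.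
  rewrite mulmxA rV_eqE forall_prodr -big_split /=; apply: eq_bigr => e _.
  have zE : (0 : 'rV[F]_n) 0 e = 0 by rewrite mxE.
  by rewrite mul_ind_row zE; case: ifP => _; rewrite ?mulN1r // eqxx mulr1.
have -> : \sum_(a : 'rV_n) (a *m B^T == 0)%:R * wt a =
    \sum_S sg S * \sum_(b : 'rV_n) (b *m (B *m diag_mx (ind_row F S))^T == 0)%:R.
  transitivity (\sum_S sg S * \sum_(a : 'rV_n) (a *m B^T == 0)%:R
      * \prod_e (if e \in S then 1 else q * (a 0 e == 0)%:R)).
    under [RHS]eq_bigr do rewrite mulr_sumr.
    rewrite exchange_big /=; apply: eq_bigr => a _.
    under [RHS]eq_bigr do rewrite mulrCA.
    rewrite -mulr_sumr; congr (_ * _).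
    rewrite /wt; under eq_bigr do rewrite addrC.
    rewrite bigA_distr /=; apply: eq_bigr => S _.
    by rewrite -big_split /=; apply: eq_bigr => e _; case: ifP; rewrite ?mulr1 ?mul1r.
  apply: eq_bigr => S _; congr (_ * _).
  rewrite -(sum_mul_ind_row S (fun a => (a *m B^T == 0)%:R)).
  by apply: eq_bigr => b _; rewrite trmx_mul tr_diag_mx mulmxA.
rewrite !mulr_sumr; apply: eq_bigr => S _; rewrite mulrCA [RHS]mulrCA.
congr (_ * _); rewrite !sum_kernel mxrank_tr -!exprD.
by congr (q ^+ _); rewrite addnBA ?rank_leq_row // addnBA ?rank_leq_col // addnC.
Qed.

Lemma sum_wt n : (0 < n)%N -> \sum_(a : 'rV[F]_n) wt a = 0.
Proof.
case: n => // n _; rewrite (sum_rV_prod (fun _ t => q * (t == 0)%:R - 1)).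
rewrite big_ord_recl /= (_ : \sum_t _ = 0) ?mul0r //.
rewrite sumrB -mulr_sumr (bigD1 0) //= eqxx big1 => [|t /negPf-> //].
by rewrite addr0 mulr1 sumr_const subrr.
Qed.

Lemma wt_even n (a : 'rV[F]_n) : ~~ odd n ->
  wt a = \sum_(S : {set 'I_n}) (- q) ^+ #|S| * [forall e in S, a 0 e == 0]%:R.
Proof.
move=> n_even.
transitivity (\prod_e (- q * (a 0 e == 0)%:R + 1)).
  rewrite /wt; under [LHS]eq_bigr do rewrite -[_ - _]opprK opprB addrC -mulNr.
  by rewrite prodrN card_ord -signr_odd (negPf n_even) mul1r.
rewrite bigA_distr /=; apply: eq_bigr => S _.
rewrite -big_mkcond /= big_split /= prodr_const; congr (_ * _).
rewrite forall_prodr [LHS]big_mkcond /=; apply: eq_bigr => e _.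
by case: (e \in S).
Qed.

End FullSupport.

(** * The two counts modulo the cube of the field size *)

Section ModQ3.
Variable F : finFieldType.
Local Notation q := (#|F|%:R : int).
Variables (h n : nat) (A : 'M[F]_(h, n)).
Implicit Types (a : 'rV[F]_n) (x y : 'rV[F]_h) (S : {set 'I_n}).

(** In the arguments, x and x' stand for the components p^+ and p'^+,
    and y and y' for p^- and p'^-. *)
Definition num_nonvanishing : int :=
  \sum_(x : 'rV[F]_h) \sum_(x' : 'rV[F]_h) \sum_(y : 'rV[F]_h) \sum_(y' : 'rV[F]_h)
    [forall e, (x *m A) 0 e * (y *m A) 0 e
             + (x' *m A) 0 e * (y' *m A) 0 e != 0]%:R.

(** For fixed x and x', the values of the quadrics form the linear
    code generated by [B x x'], whose dual consists of the weights [a] with x and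
    x' in the kernel of the Gram matrix. *)
Lemma num_nonvanishingE :
  q ^+ n * num_nonvanishing = q ^+ (2 * h) * \sum_a kersize A a ^+ 2 * wt a.
Proof.
pose B x x' : 'M[F]_(h + h, n) :=
  col_mx (A *m diag_mx (x *m A)) (A *m diag_mx (x' *m A)).
have -> : num_nonvanishing = \sum_(x : 'rV[F]_h) \sum_(x' : 'rV[F]_h)
    \sum_(w : 'rV_(h + h)) [forall e, (w *m B x x') 0 e != 0]%:R.
  apply: eq_bigr => x _; apply: eq_bigr => x' _.
  rewrite sum_rV_split; apply: eq_bigr => y _; apply: eq_bigr => y' _.
  congr (nat_of_bool _)%:R; apply: eq_forallb => e.
  rewrite mul_row_col !mulmxA !mul_mx_diag !mxE; congr (_ + _ != _); exact: mulrC.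
rewrite [LHS]mulr_sumr; under [LHS]eq_bigr do rewrite mulr_sumr.
under [LHS]eq_bigr => x _ do under eq_bigr => x' _ do rewrite full_support_count.
under [LHS]eq_bigr do rewrite -mulr_sumr.
rewrite -mulr_sumr mul2n -addnn; congr (_ * _).
under [LHS]eq_bigr do rewrite exchange_big /=.
rewrite exchange_big /=; apply: eq_bigr => a _.
under [LHS]eq_bigr do rewrite -mulr_suml.
rewrite -mulr_suml; congr (_ * _).
rewrite expr2 /kersize mulr_suml; apply: eq_bigr => x _.
rewrite mulr_sumr; apply: eq_bigr => x' _; rewrite -natrM mulnb.
rewrite tr_col_mx !trmx_mul !tr_diag_mx mul_mx_row !mul_gram.
congr (nat_of_bool _)%:R; apply/eqP/andP => [|[/eqP-> /eqP->]]; last exact: row_mx0.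
by rewrite -[RHS]row_mx0 => /eq_row_mx [-> ->].
Qed.

Definition num_singular_on S : int :=
  \sum_(a : 'rV_n) ([forall e in S, a 0 e == 0] && (\det (gram A a) == 0))%:R.

(** Setting weights to zero deletes the corresponding columns. *)
Lemma num_singular_onE S : num_singular_on S = num_singular (A *m (sel_mx F (~: S))^T).
Proof.
pose res a : 'rV[F]_#|~: S| := \row_i a 0 (enum_val i).
have resK b : res (b *m sel_mx F (~: S)) = b.
  by apply/rowP=> i; rewrite mxE mul_sel_in.
rewrite /num_singular_on (bigID (fun a : 'rV_n => [forall e in S, a 0 e == 0])) /=.
rewrite [X in _ + X]big1 => [|a /negPf-> //].
rewrite addr0 (reindex_onto (fun b => b *m sel_mx F (~: S)) res) /=; last first.
  move=> a /forall_inP a0; apply/rowP=> e; have [eS | eS] := boolP (e \in S).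
    by rewrite mul_sel_notin ?inE ?eS //; apply/esym/eqP/a0.
  have eS' : e \in ~: S by rewrite inE.
  by rewrite -(enum_rankK_in eS' eS') mul_sel_in mxE.
apply: eq_big => [b | b]; rewrite ?resK ?eqxx ?andbT.
  by apply/forall_inP=> e eS; rewrite mul_sel_notin ?inE ?eS.
by move=> ->; rewrite gram_sel.
Qed.

(** Each weight set to zero gives a factor q and costs at most one:
    with one zero weight the odd case applies, with two a dimension count
    suffices, and from three on nothing is left to prove. *)
Lemma dvd_num_singular_on S : n = (2 * h)%N -> (3 <= h)%N -> S != set0 ->
  (q ^+ 3 %| (- q) ^+ #|S| * num_singular_on S)%Z.
Proof.
move=> n2h h3 S0; rewrite num_singular_onE.
have cS : (#|~: S| + #|S| = n)%N by rewrite addnC cardsC card_ord.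
have [S3 | S2] := leqP 3 #|S|.
  by rewrite exprNn dvdz_mulr // dvdz_mull // dvdz_exp2l.
have: (#|S| == 1%N) || (#|S| == 2)%N.
  by have := S0; rewrite -card_gt0; lia.
move=> /orP[] /eqP S1; rewrite S1 ?expr1 ?sqrrN.
  rewrite mulNr rpredN exprS dvdz_mul //; apply: dvd_num_singular_q2_odd => //; lia.
rewrite [q ^+ 3]exprSr dvdz_mul //; apply: dvd_num_singular_q; lia.
Qed.

Theorem num_nonvanishing_singular : n = (2 * h)%N -> (3 <= h)%N ->
  (q ^+ 3 %| num_nonvanishing + num_singular A)%Z.
Proof.
move=> n2h h3.
have qn0 : q ^+ (2 * h) != 0 by rewrite expf_neq0 ?q_neq0.
have -> : num_nonvanishing = \sum_a kersize A a ^+ 2 * wt a.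
  by apply: (mulfI qn0); rewrite -num_nonvanishingE n2h.
have n_even : ~~ odd n by rewrite n2h oddM.
have wt0 : \sum_(a : 'rV[F]_n) wt a = 0 by apply: sum_wt; lia.
pose nd a : int := (nondegenerate A a)%:R.
have wt1 a : (q %| wt a - 1)%Z.
  rewrite wt_even // (bigD1 set0) //= cards0 expr0 mul1r.
  rewrite (_ : [forall e in set0, _]); last by apply/forall_inP=> e; rewrite inE.
  rewrite addrAC subrr add0r; apply: rpred_sum => S S0; apply: dvdz_mulr.
  by rewrite exprNn dvdz_mull // dvdz_exp // card_gt0.
(* Up to the terms with at least one weight set to zero, the weighted count of
   nonsingular matrices is minus the number of singular ones. *)
have ndwt : \sum_a nd a * wt a + num_singular A
    = - \sum_(S : {set 'I_n} | S != set0) (- q) ^+ #|S| * num_singular_on S.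
  have -> : \sum_a nd a * wt a = - \sum_a (\det (gram A a) == 0)%:R * wt a.
    apply/eqP; rewrite -subr_eq0 opprK -big_split /= -[X in _ == X]wt0.
    apply/eqP; apply: eq_bigr => a _.
    by rewrite /nd /nondegenerate; case: eqP => _ /=; ring.
  have -> : \sum_a (\det (gram A a) == 0)%:R * wt a
      = \sum_(S : {set 'I_n}) (- q) ^+ #|S| * num_singular_on S.
    under [RHS]eq_bigr do rewrite mulr_sumr.
    rewrite exchange_big /=; apply: eq_bigr => a _.
    rewrite wt_even // mulr_sumr; apply: eq_bigr => S _.
    by rewrite -mulnb natrM; ring.
  rewrite (bigD1 set0) //= cards0 expr0 mul1r opprD addrAC.
  rewrite (_ : num_singular_on set0 = num_singular A) ?addNr ?add0r //.
  apply: eq_bigr => a _; rewrite (_ : [forall e in set0, _]) //.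
  by apply/forall_inP=> e; rewrite inE.
have -> : \sum_a kersize A a ^+ 2 * wt a + num_singular A =
    \sum_a (kersize A a ^+ 2 - nd a - q * (kersize A a - nd a)) * wt a
  + q * (\sum_a (kersize A a - nd a) * (wt a - 1) + \sum_a (kersize A a - nd a))
  + (\sum_a nd a * wt a + num_singular A).
  rewrite addrA; congr (_ + _).
  rewrite -big_split mulr_sumr -!big_split /=; apply: eq_bigr => a _; ring.
apply: rpredD; last first.
  rewrite ndwt rpredN; apply: rpred_sum => S S0; exact: dvd_num_singular_on.
apply: rpredD.
  by apply: rpred_sum => a _; apply: dvdz_mulr; exact: kersize_sqr_mod_q3.
rewrite exprS dvdz_mul //; apply: rpredD.
  apply: rpred_sum => a _; rewrite expr2; apply: dvdz_mul => //; exact: kersize_mod_q.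
rewrite sumrB; apply: rpredB.
  by apply: dvdz_trans (dvd_sum_kersize A); apply: dvdz_exp2l; lia.
have -> : \sum_a nd a = q ^+ n - num_singular A by rewrite num_singularE subKr.
apply: rpredB; first by apply: dvdz_exp2l; lia.
by apply: dvd_num_singular_q2_even => //; lia.
Qed.

End ModQ3.

(** * Unimodular minors, flows and forests *)

Section Unimodular.
Variables (h s : nat) (U : 'M[int]_(h, s)).

(** An integer matrix that is invertible over the integers has
    determinant 1 or -1. *)
Lemma det_gram_unimodular (K : 'M_(s, h)) :
  U *m K = 1%:M -> K *m U = 1%:M -> s = h /\ \det (U *m U^T) = 1.
Proof.
move=> UK KU; have sh : s = h.
  by apply/eqP; rewrite eqn_leq (mulmx1_min KU) (mulmx1_min UK).
split=> //; case: h / sh U K UK KU => V K VK _.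
have /(congr1 absz)/eqP : \det V * \det K = 1 by rewrite -det_mulmx VK det1.
rewrite abszM muln_eq1 => /andP[/eqP V1 _].
rewrite det_mulmx det_tr; move: (\det V) V1.
by case=> [[|[|k]]|[|k]].
Qed.

Lemma det_gram_lker (a : 'rV_h) : a != 0 -> a *m U = 0 -> \det (U *m U^T) = 0.
Proof. by move=> a0 aU; apply/eqP/det0P; exists a; rewrite // mulmxA aU mul0mx. Qed.

Lemma det_gram_rker (b : 'cV_s) :
  s = h -> b != 0 -> U *m b = 0 -> \det (U *m U^T) = 0.
Proof.
move=> sh; case: h / sh U => V b0 Vb.
rewrite det_mulmx det_tr (_ : \det V = 0) ?mul0r //.
apply/eqP; rewrite -det_tr; apply/det0P; exists b^T.
  by rewrite trmx_eq0.
by rewrite -trmx_mul Vb trmx0.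
Qed.

End Unimodular.

Section Flows.
Variable G : multigraph.
Local Notation n := #|edge G|.
Implicit Types (e : edge G) (d : edge G * bool) (u v : vertex G).
Implicit Types (T : {set edge G}) (z : 'rV[int]_n).

Definition vtx v : 'rV[int]_#|vertex G| := delta_mx 0 (enum_rank v).

(** The sign makes the boundary of the chain of a dart equal to its target
    minus its source in both directions. *)
Definition dart_chain d : 'rV[int]_n := (-1) ^+ d.2 *: delta_mx 0 (enum_rank d.1).

Lemma delta_boundary e :
  delta_mx 0 (enum_rank e) *m boundary G = vtx (tgt e) - vtx (src e).
Proof.
rewrite -rowE; apply/rowP=> v; rewrite !mxE enum_rankK /=.
by congr (_%:R - _%:R); rewrite -(inj_eq enum_rank_inj) enum_valK eq_sym.
Qed.

Lemma dart_boundary d :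
  dart_chain d *m boundary G = vtx (dart_tgt d) - vtx (dart_src d).
Proof.
rewrite /dart_chain -scalemxAl delta_boundary /dart_tgt /dart_src.
by case: d.2; rewrite ?expr1 ?scaleN1r ?opprB ?expr0 ?scale1r.
Qed.

Definition supported z T := forall i, z 0 i != 0 -> enum_val i \in T.

Lemma supported_dart d T : d.1 \in T -> supported (dart_chain d) T.
Proof.
move=> dT i; rewrite !mxE eqxx /=.
have [-> | _] := eqVneq i (enum_rank d.1); first by rewrite enum_rankK.
by rewrite mulr0 eqxx.
Qed.

Lemma supportedD y z T : supported y T -> supported z T -> supported (y + z) T.
Proof.
move=> yT zT i; rewrite mxE; have [y0|/yT//] := eqVneq (y 0 i) 0.
by rewrite y0 add0r => /zT.
Qed.

Lemma supported0 T : supported 0 T.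
Proof. by move=> i; rewrite mxE eqxx. Qed.

Lemma adj_dart T u v : adj T u v ->
  exists d, [/\ d.1 \in T, dart_src d = u & dart_tgt d = v].
Proof.
case/exists_inP=> e eT /orP[] /andP[/eqP<- /eqP<-].
  by exists (e, false).
by exists (e, true).
Qed.

Lemma adj_sym T u v : adj T u v = adj T v u.
Proof. by apply: eq_existsb => e; rewrite orbC. Qed.

Lemma edge_adj T e : e \in T -> adj T (src e) (tgt e).
Proof. by move=> eT; apply/exists_inP; exists e; rewrite ?eqxx. Qed.

Lemma connect_flow T u v : connect (adj T) u v ->
  exists2 z, supported z T & z *m boundary G = vtx v - vtx u.
Proof.
case/connectP=> p; elim: p u => [|w p IHp] u /= => [_ -> | /andP[uw pw] ev].
  by exists 0; rewrite ?mul0mx ?subrr //; exact: supported0.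
have [z zT zb] := IHp w pw ev; have [d [dT ds dt]] := adj_dart uw.
exists (dart_chain d + z); first exact: supportedD (supported_dart dT) zT.
by rewrite mulmxDl dart_boundary zb ds dt addrC addrA subrK.
Qed.

(** The coboundary of the indicator of a set of vertices. Flows are
    orthogonal to it. *)
Definition cut (p : pred (vertex G)) : 'cV[int]_n :=
  boundary G *m (\col_i (p (enum_val i))%:R).

Lemma cutE p i : cut p i 0 = (p (tgt (enum_val i)))%:R - (p (src (enum_val i)))%:R.
Proof.
transitivity (row i (cut p) 0 0); first by rewrite [RHS]mxE.
rewrite row_mul rowE -{1}[i]enum_valK delta_boundary mulmxBl -!rowE.
by rewrite !mxE !enum_rankK.
Qed.

Lemma cut_component T u i :
  enum_val i \in T -> cut (connect (adj T) u) i 0 = 0.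
Proof.
move=> eT; rewrite cutE; apply/eqP; rewrite subr_eq0; apply/eqP.
congr (nat_of_bool _)%:R; apply/idP/idP => uc; apply: connect_trans uc (connect1 _).
  by rewrite adj_sym edge_adj.
by rewrite edge_adj.
Qed.

(** Different steps of a path without repeated vertices use different
    edges, since an edge determines its two end points. *)
Lemma simple_dart_path T u p : path (adj T) u p -> uniq (u :: p) ->
  exists s : seq (edge G * bool),
    [/\ all (fun d => d.1 \in T) s, uniq [seq d.1 | d <- s],
        [seq dart_src d | d <- s] = belast u p & [seq dart_tgt d | d <- s] = p].
Proof.
elim: p u => [|v p IHp] u /=; first by exists [::].
case/andP=> uv pv /andP[up vp]; have [s [sT su ss st]] := IHp v pv vp.
have [d [dT ds dt]] := adj_dart uv.
exists (d :: s); split=> /=; rewrite ?dT ?ds ?dt ?ss ?st //.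
rewrite su andbT; apply: contra up => /mapP[d' d's E].
have inp w : w \in [:: dart_src d'; dart_tgt d'] -> w \in v :: p.
  rewrite !inE => /orP[] /eqP->.
    by apply: mem_belast; rewrite -ss map_f.
  by rewrite -st (map_f _ d's) orbT.
apply: inp; rewrite -ds /dart_src /dart_tgt !inE E.
by case: (d.2); case: (d'.2); rewrite eqxx ?orbT.
Qed.

Lemma dart_path_linked s d0 d1 u p :
  [seq dart_src d | d <- s] = belast u p -> [seq dart_tgt d | d <- s] = p ->
  dart_tgt d0 = u -> dart_src d1 = last u p ->
  path (fun d d' : edge G * bool => dart_tgt d == dart_src d') d0 (rcons s d1).
Proof.
elim: s d0 u p => [|d s IHs] d0 u [|v p] //=; first by move=> _ _ -> ->; rewrite eqxx.
by case=> -> ss [dt st] -> d1l; rewrite eqxx (IHs _ v p).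
Qed.

(** A simple path joining the end points of [e] closes up with [e] to a
    cycle. *)
Lemma acyclic_bridge T e : acyclic T -> e \in T ->
  ~~ connect (adj (T :\ e)) (tgt e) (src e).
Proof.
move=> acT eT; apply/negP => /connectP[p0 p0P el].
move: el; case: (shortenP p0P) => p pP pu _ el.
have [s [sT su ss st]] := simple_dart_path pP pu.
have ces : is_cycle ((e, false) :: s).
  rewrite /is_cycle /= su ss andbT; apply/and3P; split.
  - apply/negP => /mapP[d /(allP sT)]; rewrite !inE => /andP[de _] ed.
    by rewrite ed eqxx in de.
  - move: pu; rewrite lastI rcons_uniq -el /dart_src /= => /andP[-> ->] //.
  - exact: (dart_path_linked ss st).
have sz : (size s < n)%N.
  have /and4P[_ /card_uniqP /= ce _ _] := ces.
  by rewrite -(size_map (fun d => d.1) s) -ce max_card.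
have /forallP/(_ (Ordinal sz))/forallP/(_ (in_tuple ((e, false) :: s))) := acT.
rewrite /= ces /= eT /=.
by move/negP; apply; apply: sub_all sT => d; rewrite inE => /andP[].
Qed.

(** Removing an edge [e] of a forest separates its end points, and the
    flow through the resulting cut is, up to sign, the flow through [e]. *)
Lemma acyclic_flow0 T z : acyclic T -> supported z T -> z *m boundary G = 0 -> z = 0.
Proof.
move=> acT zT zb; apply/rowP=> i; rewrite [RHS]mxE.
apply/eqP; apply: contraT => zi.
have iT := zT i zi; set e := enum_val i in iT.
(* The side of [tgt e] after the removal of [e]. *)
pose c := connect (adj (T :\ e)) (tgt e).
have : (z *m cut c) 0 0 = 0 by rewrite mulmxA zb mul0mx mxE.
rewrite mxE (bigD1 i) //= big1 => [|j ji].
  rewrite addr0 cutE -/e /c connect0 (negPf (acyclic_bridge acT iT)) subr0 mulr1.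
  by move/eqP; rewrite (negPf zi).
have [-> | zj] := eqVneq (z 0 j) 0; first by rewrite mul0r.
rewrite cut_component ?mulr0 // !inE zT // andbT.
by rewrite (inj_eq enum_val_inj).
Qed.

(** The sum of the darts of a cycle is a flow, and it is nonzero because no
    edge is repeated. *)
Lemma cyclic_flow T : ~~ acyclic T ->
  exists z, [/\ supported z T, z *m boundary G = 0 & z != 0].
Proof.
rewrite negb_forall => /existsP[k]; rewrite negb_forall => /existsP[s].
rewrite negb_imply negbK => /andP[sT].
case: {s}(tval s) sT => [|d s] //= /andP[dT sT] /and4P[_ /= /andP[ds su] _ sc].
exists (\sum_(d' <- d :: s) dart_chain d'); split.
- rewrite big_cons; apply: supportedD (supported_dart dT) _.
  elim: s sT {ds su sc} => [|d' s IHs] /=.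
    by rewrite big_nil => _; exact: supported0.
  case/andP=> d'T sT; rewrite big_cons.
  by apply: supportedD (supported_dart d'T) (IHs sT).
- rewrite mulmx_suml; under eq_bigr do rewrite dart_boundary.
  have tele d0 t : path (fun d d' : edge G * bool => dart_tgt d == dart_src d') d0 t ->
      \sum_(d' <- d0 :: t) (vtx (dart_tgt d') - vtx (dart_src d')) =
      vtx (dart_tgt (last d0 t)) - vtx (dart_src d0).
    elim: t d0 => [|d1 t IHt] d0 /=; first by rewrite big_seq1.
    case/andP=> /eqP dd /IHt E; rewrite big_cons E dd addrC addrA; congr (_ - _).
    by rewrite subrK.
  move: sc; rewrite rcons_path => /andP[/tele-> /eqP->]; exact: subrr.
- apply/eqP=> /rowP/(_ (enum_rank d.1))/eqP; rewrite mxE.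
  rewrite summxE big_cons big_seq big1 => [|d' d's].
    by rewrite !mxE !eqxx mulr1 addr0 signr_eq0.
  rewrite !mxE eqxx /= (inj_eq enum_rank_inj).
  case: eqP => [dd' | _]; last by rewrite mulr0.
  by case/negP: ds; rewrite dd' map_f.
Qed.

End Flows.

(** * The matrix-tree theorem and the two invariants *)

Section MatrixTree.
Variable G : multigraph.
Local Notation n := #|edge G|.
Local Notation h := (betti G).
Variable c : 'M[int]_(h, n).
Hypothesis Gconn : connected G.
Hypothesis c_basis : cycle_basis c.
Implicit Types (S : {set 'I_n}) (z : 'rV[int]_n).

Definition edges_off S : {set edge G} := [set e | enum_rank e \notin S].

Lemma mem_edges_off S i : (enum_val i \in edges_off S) = (i \notin S).
Proof. by rewrite inE enum_valK. Qed.

Lemma cycle_basis_inj m (a : 'M[int]_(m, h)) : a *m c = 0 -> a = 0.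
Proof.
move=> ac; apply/row_matrixP=> i; rewrite row0.
have [b [_ bU]] := c_basis.2 0 (mul0mx _ _).
by rewrite -(bU 0 (mul0mx _ _)) (bU (row i a)) // -row_mul ac row0.
Qed.

Lemma supported_edges_off S z : supported z (edges_off S) <-> z *m (sel_mx int S)^T = 0.
Proof.
split=> [zS | zS i zi].
  apply/rowP=> i; rewrite mul_trsel [RHS]mxE; apply/eqP/negP => /negP /zS.
  by rewrite mem_edges_off enum_valP.
rewrite mem_edges_off; apply: contra zi => iS.
move/rowP/(_ (enum_rank_in iS i)): zS.
by rewrite mul_trsel enum_rankK_in // [RHS]mxE => ->.
Qed.

(** Each edge off the spanning subgraph closes up inside it to a cycle
    that uses no other such edge. So the restriction of the lattice of flows to
    these edges is surjective. *)
Lemma fundamental_cycles S : connected_by (edges_off S) ->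
  exists K : 'M_(#|S|, h), K *m (c *m (sel_mx int S)^T) = 1%:M.
Proof.
case/andP=> _ /forallP conn.
have /fin_all_exists[a aP] (i : 'I_#|S|) :
    exists a : 'rV_h, a *m c *m (sel_mx int S)^T = delta_mx 0 i.
  pose e := enum_val (enum_val i).
  have /connect_flow[z zT zb] := forallP (conn (tgt e)) (src e).
  have [a [ac _]] : exists! a, a *m c = z + dart_chain (e, false).
    apply: c_basis.2; rewrite mulmxDl zb dart_boundary /=.
    by rewrite /dart_tgt /dart_src /= addrC addrA subrK subrr.
  exists a; rewrite ac mulmxDl (supported_edges_off S z).1 // add0r.
  apply/rowP=> j; rewrite mul_trsel !mxE expr0 mul1r !eqxx /= /e enum_valK.
  by rewrite (inj_eq enum_val_inj).
exists (\matrix_i a i); apply/row_matrixP=> i.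
by rewrite row_mul rowK mulmxA aP row1.
Qed.

(** For a spanning tree, the restriction of integer flows to the edges off
    the tree is surjective by the fundamental cycles and injective because a
    forest carries no flow. So it is unimodular; this also shows that the number
    of these edges is the Betti number. *)
Lemma det_gram_tree S : spanning_tree (edges_off S) ->
  #|S| = h /\ \det (gram c (ind_row int S)) = 1.
Proof.
case/andP=> conn acT; have [K KU] := fundamental_cycles conn.
rewrite gram_ind; apply: (det_gram_unimodular _ KU).
set U := c *m _ in KU *.
suff: (U *m K - 1%:M) *m c = 0 by move/cycle_basis_inj/eqP; rewrite subr_eq0 => /eqP.
apply/row_matrixP=> i; rewrite row0; apply: (acyclic_flow0 acT).
  apply/supported_edges_off; rewrite -row_mul -mulmxA -/U mulmxBl -mulmxA KU.
  by rewrite mulmx1 mul1mx subrr row0.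
by rewrite -row_mul -mulmxA c_basis.1 mulmx0 row0.
Qed.

(** If the remaining edges contain a cycle, its flow restricts to zero on
    [S], so the rows of the minor are dependent. If they do not connect the
    graph, the cut around a component is supported on [S] and orthogonal to all
    flows, so the columns are dependent. *)
Lemma det_gram_nontree S : #|S| = h -> ~~ spanning_tree (edges_off S) ->
  \det (gram c (ind_row int S)) = 0.
Proof.
move=> Sh; rewrite negb_and gram_ind => /orP[|/cyclic_flow[z [zT zb z0]]]; last first.
  have [a [az _]] := c_basis.2 z zb.
  apply: (@det_gram_lker _ _ _ a).
    by apply: contra z0 => /eqP a0; rewrite -az a0 mul0mx.
  by rewrite mulmxA az; apply/supported_edges_off.
have /andP[V0 /forallP/= Gc] := Gconn.
rewrite /connected_by V0 /= negb_forall => /existsP[u].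
rewrite negb_forall => /existsP[v uv].
pose b := cut (connect (adj (edges_off S)) u).
have b0 i : i \notin S -> b i 0 = 0 by rewrite -mem_edges_off; exact: cut_component.
have selb : (sel_mx int S)^T *m (sel_mx int S *m b) = b.
  rewrite mulmxA mul_trsel_sel; apply/colP=> i.
  rewrite mul_diag_mx [LHS]mxE [X in X * _]mxE.
  by have [iS | /b0->] := boolP (i \in S); rewrite ?mul1r // mul0r.
apply: (@det_gram_rker _ _ _ (sel_mx int S *m b) Sh); last first.
  by rewrite -mulmxA selb /b /cut mulmxA c_basis.1 mul0mx.
apply/eqP=> sb0; have cut0 : b = 0 by rewrite -selb sb0 mulmx0.
case/negP: uv; have := forallP (Gc u) v; case/connectP=> p pP ->.
have step w w' : adj [set: edge G] w w' ->
    connect (adj (edges_off S)) u w = connect (adj (edges_off S)) u w'.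
  case/exists_inP=> e _ E; move/colP/(_ (enum_rank e)): cut0.
  rewrite cutE mxE enum_rankK => /eqP; rewrite subr_eq0 => tsE.
  have {}tsE : connect (adj (edges_off S)) u (tgt e) =
      connect (adj (edges_off S)) u (src e).
    by move: tsE; do 2!case: (connect _ _ _).
  by case/orP: E => /andP[/eqP<- /eqP<-].
suff walk w : path (adj [set: edge G]) w p ->
    connect (adj (edges_off S)) u w = connect (adj (edges_off S)) u (last w p).
  by rewrite -(walk u pP) connect0.
elim: p w {pP} => [|w' p IHp] w //= /andP[ww' pw'].
by rewrite (step _ _ ww') IHp.
Qed.

(** The matrix-tree theorem: in the Cauchy-Binet expansion, the coefficient of
    the complement of a spanning tree is 1 and all others vanish. *)
Theorem graph_poly_det (F : finFieldType) (x : 'I_n -> F) :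
  (map_mpoly (intr : int -> F) (graph_poly G)).@[x] =
  \det (gram (map_mx intr c) (\row_i x i)).
Proof.
rewrite det_gram_sum.
transitivity (\sum_(S : {set 'I_n} | spanning_tree (edges_off S)) \prod_(i in S) x i).
  rewrite /graph_poly [map_mpoly _ _]rmorph_sum [LHS]rmorph_sum.
  rewrite (reindex edges_off) /=; last first.
    exists (fun T : {set edge G} => [set i | enum_val i \notin T]) => T _;
      apply/setP=> i.
      by rewrite !inE enum_valK negbK.
    by rewrite !inE enum_rankK negbK.
  apply: eq_bigr => S _; rewrite [map_mpoly _ _]rmorph_prod [LHS]rmorph_prod /=.
  rewrite (reindex (@enum_val _ (edge G))) /=; last first.
    by apply: onW_bij; exact: enum_val_bij.
  apply: eq_big => [i | i _]; first by rewrite mem_edges_off negbK.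
  by rewrite map_mpolyX mevalXU enum_valK.
rewrite big_mkcond [RHS]big_mkcond /=; apply: eq_bigr => S _.
have -> : gram (map_mx intr c) (ind_row F S) = map_mx intr (gram c (ind_row int S)).
  rewrite /gram !map_mxM map_trmx map_diag_mx; congr (_ *m diag_mx _ *m _).
  by apply/rowP=> i; rewrite !mxE rmorph_nat.
rewrite det_map_mx; case: ifP => [treeS | /negbT treeS].
  have [-> ->] := det_gram_tree treeS; rewrite eqxx rmorph1 mulr1.
  by apply: eq_bigr => i _; rewrite mxE.
by case: eqP => // Sh; rewrite (det_gram_nontree Sh treeS) rmorph0 mulr0.
Qed.

End MatrixTree.

Section PointCounts.
Variables (F : finFieldType) (G : multigraph).
Local Notation n := #|edge G|.
Local Notation h := (betti G).
Variable c : 'M[int]_(h, n).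
Local Notation A := (map_mx (intr : int -> F) c).
Local Notation q := (#|F|%:R : int).

Lemma point_count_graph : connected G -> cycle_basis c ->
  (point_count F [:: graph_poly G])%:R = num_singular A.
Proof.
move=> Gc cb; rewrite /point_count -sumr_bool /num_singular.
rewrite (reindex (fun a : 'rV[F]_n => [ffun i => a 0 i])) /=.
  apply: eq_bigr => a _; rewrite andbT (graph_poly_det Gc cb).
  congr (\det (gram _ _) == 0)%:R.
  by apply/rowP=> i; rewrite mxE ffunE.
exists (fun f : {ffun 'I_n -> F} => \row_i f i) => [a | f] _.
  by apply/rowP=> i; rewrite mxE ffunE.
by apply/ffunP=> i; rewrite ffunE mxE.
Qed.

(** The momentum of an edge at a point is the corresponding coordinate of the
    flow with coefficients [mom a]. *)
Lemma quadric_eval (e : edge G) (p : 'I_(h * 4) -> F) :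
  let mom (a : 'I_4) : 'rV_h := \row_i p (mxvec_index i a) in
  let m a := (mom a *m A) 0 (enum_rank e) in
  (map_mpoly (intr : int -> F) (edge_quadric c e)).@[p] = m 0 * m 1 + m 2 * m 3.
Proof.
move=> mom m.
have mE a : (map_mpoly (intr : int -> F) (edge_momentum c e a)).@[p] = m a.
  rewrite /edge_momentum [map_mpoly _ _]rmorph_sum [LHS]rmorph_sum.
  rewrite /m mxE; apply: eq_bigr => i _.
  by rewrite /= map_mpolyZ mevalZ map_mpolyX mevalXU !mxE mulrC.
rewrite /edge_quadric [map_mpoly _ _]rmorphD [LHS]rmorphD.
by rewrite /= ![map_mpoly _ (_ * _)]rmorphM !mevalM !mE.
Qed.

Lemma point_count_mom :
  (point_count F [:: momentum_poly c])%:R = q ^+ (h * 4) - num_nonvanishing A.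
Proof.
have -> : q ^+ (h * 4) = \sum_(p : {ffun 'I_(h * 4) -> F}) 1.
  by rewrite sumr_const card_ffun card_ord natrX.
have -> : num_nonvanishing A = \sum_(p : {ffun 'I_(h * 4) -> F})
    ((map_mpoly (intr : int -> F) (momentum_poly c)).@[p] != 0)%:R.
  pose mom (p : {ffun 'I_(h * 4) -> F}) a : 'rV[F]_h := \row_i p (mxvec_index i a).
  (* The components 0, 1, 2, 3 of a momentum are x, y, x', y'. *)
  pose join (w : 'rV[F]_h * 'rV[F]_h * 'rV[F]_h * 'rV[F]_h) : {ffun 'I_(h * 4) -> F} :=
    let: (x, x', y, y') := w in
    [ffun k : 'I_(h * 4) =>
       mxvec (\matrix_(i < h, a < 4) ([:: x; y; x'; y']`_a : 'rV_h) 0 i) 0 k].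
  have joinE x x' y y' a : mom (join (x, x', y, y')) a = [:: x; y; x'; y']`_a.
    by apply/rowP=> i; rewrite mxE ffunE mxvecE mxE.
  rewrite /num_nonvanishing pair_bigA pair_bigA pair_bigA /=.
  rewrite [RHS](reindex join) /=; last first.
    exists (fun p => (mom p 0, mom p 2, mom p 1, mom p 3)) => [[[[x x'] y] y'] _ | p _].
      by rewrite !joinE.
    apply/ffunP=> k; rewrite /join ffunE; case/mxvec_indexP: k => i a.
    rewrite mxvecE mxE; case: a => [[|[|[|[|//]]]] lta] /=;
      by rewrite mxE; congr (p (mxvec_index i _)); apply: val_inj.
  apply: eq_bigr => -[[[x x'] y] y'] _; congr (nat_of_bool _)%:R.
  rewrite /momentum_poly [map_mpoly _ _]rmorph_prod [meval _ _]rmorph_prod /=.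
  apply/forallP/prodf_neq0 => [nz e _ | nz i].
    by rewrite quadric_eval -![\row_i _]/(mom _ _) !joinE; exact: nz.
  have := nz (enum_val i) isT.
  by rewrite quadric_eval -![\row_i _]/(mom _ _) !joinE enum_valK.
rewrite /point_count -sumr_bool -sumrB; apply: eq_bigr => p _ /=.
by rewrite andbT; case: eqP.
Qed.

End PointCounts.

Lemma divn_mod_square (q a b : nat) :
  (0 < q)%N -> a = b %[mod q ^ 3] -> a %/ q ^ 2 = b %/ q ^ 2 %[mod q].
Proof.
move=> q0 E; have q2 : (0 < q ^ 2)%N by rewrite expn_gt0 q0.
have step m : m %/ q ^ 2 = (m %% q ^ 3) %/ q ^ 2 %[mod q].
  by rewrite {1}(divn_eq m (q ^ 3)) expnS mulnA divnMDl // modnMDl.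
by rewrite step E -step.
Qed.

Theorem theorem3 (G : multigraph) (Gconn : connected G)
    (h_ge3 : (3 <= betti G)%N) (h_N : (2 * betti G)%N = #|edge G|)
    (c : 'M[int]_(betti G, #|edge G|)) (c_basis : cycle_basis c)
    (F : finFieldType) :
  c2mom F c = c2 F G.
Proof.
have q_gt1 : (1 < #|F|)%N by exact: card_finNzRing_gt1.
apply: val_inj; rewrite /c2mom /c2 /= !val_Zp_nat //.
apply: divn_mod_square; first exact: ltnW.
set a := point_count _ _; set b := point_count _ _.
have dvd : ((#|F| ^ 3)%N%:Z %| a%:Z - b%:Z)%Z.
  rewrite -[a%:Z]natz -[b%:Z]natz -[X in (X %| _)%Z]natz natrX.
  rewrite /a /b point_count_mom (point_count_graph F Gconn c_basis).
  rewrite -addrA -opprD; apply: rpredB; first by apply: dvdz_exp2l; lia.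
  exact: num_nonvanishing_singular.
by move: dvd; rewrite -eqz_mod_dvd !modz_nat => /eqP[].
Qed.
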